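(* Let $x_1,\dots,x_n\in\mathcal X$ be fixed with $x_i\neq x_j$ for $i\neq j$, let $\boldsymbol K=\bigl(k(x_i,x_j)\bigr)_{i,j=1}^n$ be the kernel matrix, assumed invertible, and let $\mu$ be a (general, not necessarily probability) measure on $\mathcal X$ with embedding $\mu_k$. Consider the problem of minimizing $\|\mu_k-\mu^n_k\|_k$ over all weight vectors $\boldsymbol\mu=[\mu_1,\dots,\mu_n]^\top\in\mathbb R^n$, where $\mu^n=\sum_{i=1}^n\mu_i\,\delta_{x_i}$. The optimal weights (the minimizer of this problem) are given by $$\boldsymbol\mu=\boldsymbol K^{-1}\boldsymbol m,$$ where $\boldsymbol m=[m_1,\dots,m_n]^\top$ has entries $m_i=\mu_k(x_i)=\int_{\mathcal X}k(x_i,\xi)\,\mu(\mathrm d\xi)$, $i=1,\dots,n$.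
   Context: $\mathcal X$ is a measurable space and $(\mathcal H_k,\|\cdot\|_k)$ is a reproducing kernel Hilbert space of real functions on $\mathcal X$ with (measurable, symmetric, positive semidefinite) kernel $k:\mathcal X\times\mathcal X\to\mathbb R$, so that $\langle k(x,\cdot),k(y,\cdot)\rangle_k=k(x,y)$. For a measure $\mu$ on $\mathcal X$, the kernel embedding is $\mu_k(\cdot)=\int_{\mathcal X}k(\cdot,\xi)\,\mu(\mathrm d\xi)$. Standing assumption (embedding well defined): $\mu$ is $\sigma$-finite, every $f\in\mathcal H_k$ is $\mu$-integrable, $\mu_k\in\mathcal H_k$ with $\langle f,\mu_k\rangle_k=\int f\,\mathrm d\mu$ for all $f\in\mathcal H_k$, and $k$ is $\mu\otimes\mu$-integrable. $\delta_x$ is the Dirac measure at $x$, and for $\mu^n=\sum_i\mu_i\delta_{x_i}$ with real weights (possibly negative) the embedding is $\mu^n_k=\sum_{i=1}^n\mu_i\,k(x_i,\cdot)\in\mathcal H_k$. *)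

(* Defs.v *)
From mathcomp Require Export all_boot all_order all_algebra.
From mathcomp Require Export all_classical all_reals all_analysis.
Export Order.TTheory GRing.Theory Num.Theory.
Export numFieldNormedType.Exports.

Set Implicit Arguments.
Unset Strict Implicit.
Unset Printing Implicit Defensive.

Local Open Scope classical_set_scope.
Local Open Scope ring_scope.

Record is_kernel (R : realType) (d : measure_display) (X : measurableType d)
    (k : X -> X -> R) : Prop := IsKernel {
  kernel_measurable : measurable_fun [set: X * X] (fun z : X * X => k z.1 z.2);
  kernel_sym : forall x y, k x y = k y x;
  kernel_psd : forall (n : nat) (x : 'I_n -> X) (c : 'I_n -> R),
    0 <= \sum_(i < n) \sum_(j < n) c i * c j * k (x i) (x j) }.

(* The elements of the Hilbert space are identified with real functions on X
   through the injective linear map [rkhs_fun]; [R^o] is [R] viewed as a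
   module over itself. *)
Record rkhs (R : realType) (X : Type) (k : X -> X -> R) := RKHS {
  rkhs_space :> completeNormedModType R;
  rkhs_dot : {dot rkhs_space for @idfun R};
  rkhs_normE : forall f : rkhs_space, `|f| = Num.sqrt (rkhs_dot f f);
  rkhs_fun : {linear rkhs_space -> (X -> R^o)};
  rkhs_fun_inj : injective rkhs_fun;
  rkhs_section : X -> rkhs_space;
  rkhs_sectionE : forall x y, rkhs_fun (rkhs_section x) y = k x y;
  rkhs_reproducing : forall (f : rkhs_space) (x : X),
    rkhs_dot f (rkhs_section x) = rkhs_fun f x }.

Arguments rkhs_dot {R X k r}.
Arguments rkhs_fun {R X k r}.

Section Embedding.
Context (R : realType) (d : measure_display) (X : measurableType d).
Context (k : X -> X -> R).

Definition embedding_fun (mu : {measure set X -> \bar R}) : X -> R :=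
  fun x => \int[mu]_xi k x xi.

(* [muk] is the element of [H] whose underlying function is the integral
   x |-> \int k(x, xi) mu(dxi); sigma-finiteness is carried by the type of
   [mu]. *)
Record is_embedding (H : rkhs k) (mu : {sigma_finite_measure set X -> \bar R})
    (muk : H) : Prop := IsEmbedding {
  rkhs_integrable : forall f : H,
    mu.-integrable [set: X] (fun x => (rkhs_fun f x)%:E);
  embedding_funE : forall x, rkhs_fun muk x = embedding_fun mu x;
  embedding_dot : forall f : H, rkhs_dot f muk = \int[mu]_x rkhs_fun f x;
  kernel_integrable :
    (mu \x mu)%E.-integrable [set: X * X] (fun z : X * X => (k z.1 z.2)%:E) }.

(* Embedding of the signed measure \sum_i w_i \d_(x_i). *)
Definition discrete_embedding (H : rkhs k) (n : nat) (x : 'I_n -> X)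
    (w : 'cV[R]_n) : H :=
  \sum_(i < n) w i 0 *: rkhs_section H (x i).

Definition kernel_mx (n : nat) (x : 'I_n -> X) : 'M[R]_n :=
  \matrix_(i < n, j < n) k (x i) (x j).

Definition embedding_vec (mu : {measure set X -> \bar R}) (n : nat) (x : 'I_n -> X) :
    'cV[R]_n :=
  \col_(i < n) embedding_fun mu (x i).

End Embedding.

Definition is_minimizer (R : realType) (T : Type) (J : T -> R) (w : T) : Prop :=
  forall v, J w <= J v.

(* Main.v *)
Require Import Defs.

Local Open Scope classical_set_scope.
Local Open Scope ring_scope.

(** The problem is an orthogonal projection onto the finite-dimensional span of
    the sections k(x_i, .).  By the reproducing property, evaluating
    mu_k - \sum_j w_j k(x_j, .) at x_i gives both m_i - (K w)_i and the inner
    product of the residual with k(x_i, .).  Hence the weights w = K^-1 m are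
    exactly those for which the residual vanishes at every node, that is, is
    orthogonal to the span ([residual_at_nodes], [dot_discrete_embedding]).
    By Pythagoras, changing these weights to v adds the square of the norm of
    the embedding of w - v to the squared error ([discrete_embedding_error]).
    So w is a minimizer, and any other minimizer v has the same embedding as w;
    as K is invertible, weights are determined by the values of their embedding
    at the nodes ([discrete_embedding_inj]), so v = w. *)

Section RKHSGeometry.
Context (R : realType) (X : Type) (k : X -> X -> R) (H : rkhs k).
Implicit Types f g : H.

Lemma rkhs_dotC f g : rkhs_dot f g = rkhs_dot g f.
Proof. by rewrite hermC expr0 mul1r. Qed.

Lemma rkhs_dot_ge0 f : 0 <= rkhs_dot f f.
Proof.
have [->|f0] := eqVneq f 0; first by rewrite linear0r.
exact/ltW/neq0_dnorm_gt0.
Qed.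

Lemma rkhs_norm_sqr f : `|f| ^+ 2 = rkhs_dot f f.
Proof. by rewrite rkhs_normE sqr_sqrtr ?rkhs_dot_ge0. Qed.

Lemma rkhs_pythagoras f g :
  rkhs_dot f g = 0 -> `|f + g| ^+ 2 = `|f| ^+ 2 + `|g| ^+ 2.
Proof.
move=> fg0; rewrite !rkhs_norm_sqr linearDl !linearDr /=.
by rewrite (rkhs_dotC g f) fg0 addr0 add0r.
Qed.

End RKHSGeometry.

Section DiscreteEmbedding.
Context (R : realType) (d : measure_display) (X : measurableType d).
Context (k : X -> X -> R) (H : rkhs k) (n : nat) (x : 'I_n -> X).
Implicit Types (u v w : 'cV[R]_n) (f : H).

Lemma discrete_embeddingB u v :
  discrete_embedding H x (u - v) =
  discrete_embedding H x u - discrete_embedding H x v.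
Proof.
by rewrite -sumrB; apply: eq_bigr => i _; rewrite !mxE scalerBl.
Qed.

(** The reproducing property, extended linearly: the right-hand side is the
    integral of f against the signed measure with weights v.  It turns
    vanishing at the nodes into orthogonality to all discrete embeddings. *)
Lemma dot_discrete_embedding f v :
  rkhs_dot f (discrete_embedding H x v) =
  \sum_(i < n) v i 0 * rkhs_fun f (x i).
Proof.
rewrite linear_sumr; apply: eq_bigr => i _.
by rewrite linearZr_LR /= rkhs_reproducing.
Qed.

Lemma discrete_embedding_at_nodes v i :
  rkhs_fun (discrete_embedding H x v) (x i) = (kernel_mx k x *m v) i 0.
Proof.
(* The symmetry of the inner product exchanges the two arguments of k. *)
rewrite -rkhs_reproducing rkhs_dotC dot_discrete_embedding mxE.
by apply: eq_bigr => j _; rewrite mxE rkhs_sectionE mulrC.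
Qed.

Hypothesis hK : kernel_mx k x \in unitmx.

(** The values of an embedding at the nodes are K times its weights, so
    multiplying them by K^-1 recovers the weights. *)
Lemma discrete_embedding_inj : injective (discrete_embedding H x).
Proof.
move=> u v uv; rewrite -[u](mulKmx hK) -[v](mulKmx hK); congr (_ *m _).
apply/matrixP => i j; rewrite (ord1 j).
by rewrite -!discrete_embedding_at_nodes uv.
Qed.

Context (mu : {sigma_finite_measure set X -> \bar R}) (muk : H).
Hypothesis hmu : is_embedding mu muk.

Let w0 := invmx (kernel_mx k x) *m embedding_vec k mu x.

Lemma residual_at_nodes i :
  rkhs_fun (muk - discrete_embedding H x w0) (x i) = 0.
Proof.
rewrite -rkhs_reproducing linearBl /= !rkhs_reproducing.
rewrite discrete_embedding_at_nodes mulKVmx // (embedding_funE hmu) mxE.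
exact: subrr.
Qed.

(** Split the error at v as the residual at the optimal weights w0 plus the
    embedding of w0 - v; the residual vanishes at the nodes, so the two parts
    are orthogonal.  Both optimality and uniqueness of w0 are read off this. *)
Lemma discrete_embedding_error v :
  `|muk - discrete_embedding H x v| ^+ 2 =
  `|muk - discrete_embedding H x w0| ^+ 2 +
  `|discrete_embedding H x (w0 - v)| ^+ 2.
Proof.
rewrite -rkhs_pythagoras; first by rewrite discrete_embeddingB subrKA.
rewrite dot_discrete_embedding big1 // => i _.
by rewrite residual_at_nodes mulr0.
Qed.

End DiscreteEmbedding.

Arguments discrete_embedding_inj {R d X k H n x}.
Arguments discrete_embedding_error {R d X k H n x} hK {mu muk}.

Theorem proposition1 (R : realType) (d : measure_display)
    (X : measurableType d) (k : X -> X -> R) (hk : is_kernel k) (H : rkhs k)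
    (mu : {sigma_finite_measure set X -> \bar R}) (muk : H)
    (hmu : is_embedding mu muk) (n : nat) (x : 'I_n -> X) (hx : injective x)
    (hK : kernel_mx k x \in unitmx) (w : 'cV[R]_n) :
  is_minimizer (fun v : 'cV[R]_n => `|muk - discrete_embedding H x v|) w <->
  w = invmx (kernel_mx k x) *m embedding_vec k mu x.
Proof.
have errorE := discrete_embedding_error hK hmu.
split=> [wmin|-> v]; last first.
  by rewrite -ler_sqr ?nnegrE // (errorE v) lerDl sqr_ge0.
have := wmin (invmx (kernel_mx k x) *m embedding_vec k mu x).
rewrite -ler_sqr ?nnegrE // (errorE w) gerDl => le0.
have /eqP : `|discrete_embedding H x
    (invmx (kernel_mx k x) *m embedding_vec k mu x - w)| ^+ 2 = 0.
  by apply/le_anti; rewrite le0 sqr_ge0.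
rewrite sqrf_eq0 normr_eq0 discrete_embeddingB subr_eq0 => /eqP eqw.
exact/esym/(discrete_embedding_inj hK _ _ eqw).
Qed.
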